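(* Let $Z=\{z_i\}_{i=1}^n\subset\mathbb{D}\setminus\{0\}$ be a set of $n$ distinct points. Then the Shapiro-Shields function $g_Z$ is $H$-inner and is given by $$g_Z(z)=\frac{f_Z(z)}{\sqrt{\overline{|K_Z|}\,f_Z(0)}}.$$
   Context: Let $\omega=(\omega_k)_{k\ge 0}$ be a sequence of positive real numbers with $\omega_0=1$ and $\lim_{k\to\infty}\omega_k/\omega_{k+1}=1$. Let $\mathbb{D}$ be the open unit disk in $\mathbb{C}$. $H=H^2_\omega$ is the Hilbert space of holomorphic functions $f(z)=\sum_{k\ge0}a_kz^k$ on $\mathbb{D}$ with $\|f\|_\omega^2:=\sum_{k\ge0}|a_k|^2\omega_k<\infty$, with inner product $\langle\sum a_kz^k,\sum b_kz^k\rangle=\sum_k a_k\overline{b_k}\,\omega_k$. For $w\in\mathbb{D}$, $k_w(z)=\sum_{k\ge0}\overline{w}^kz^k/\omega_k$ is the reproducing kernel of $H$ at $w$, so $g(w)=\langle g,k_w\rangle$ for $g\in H$. A function $f\in H$ is called $H$-inner if $\|f\|_\omega=1$ and $\langle z^jf,f\rangle=0$ for all integers $j>0$. For $Z=\{z_1,\dots,z_n\}$, $K_Z$ is the $n\times n$ matrix with entries $K_{i,j}=\langle k_{z_i},k_{z_j}\rangle$, $i,j=1,\dots,n$, and $|M|$ denotes the determinant of a square matrix $M$. The function $f_Z$ is the $(n+1)\times(n+1)$ determinant $$f_Z(z)=\begin{vmatrix}1&1&\cdots&1\\ k_{z_1}(z)&K_{1,1}&\cdots&K_{1,n}\\ \vdots&\vdots&&\vdots\\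 k_{z_n}(z)&K_{n,1}&\cdots&K_{n,n}\end{vmatrix},$$ and the Shapiro-Shields function for $Z$ is $g_Z:=f_Z/\|f_Z\|_\omega$. *)

(* Defs.v *)
From mathcomp Require Import all_boot all_order all_algebra.
From mathcomp Require Import all_classical all_reals all_analysis.
From mathcomp Require Import complex.
Set Implicit Arguments.
Unset Strict Implicit.
Unset Printing Implicit Defensive.
Import Order.TTheory GRing.Theory Num.Theory.
Import numFieldNormedType.Exports.
Local Open Scope classical_set_scope.
Local Open Scope complex_scope.
Local Open Scope ring_scope.

Section WeightedHardySpace.
Context {R : realType}.
Local Notation C := R[i].
Implicit Types (omega : nat -> R) (f g : C -> C) (a b u : nat -> C).
Implicit Types (w x s : C).

(* MathComp-Analysis puts the topology of the norm of [C] on its alias [C^o]. *)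
Definition is_csum u s : Prop :=
  series (u : nat -> C^o) @ \oo --> (s : C^o).

Definition csum u : C := limn (series (u : nat -> C^o)).

(* A function on the open unit disk is represented by a total function on [C];
   its values outside the disk are irrelevant. *)
Definition is_taylor f a : Prop :=
  forall x, `|x| < 1 -> is_csum (fun k => a k * x ^+ k) (f x).

(* The coefficients of [f], which are unique when they exist. *)
Definition taylor f : nat -> C := xget (fun=> 0) [set a | is_taylor f a].

Definition sqnorm_term omega a (k : nat) : R :=
  Normc.normc (a k) ^+ 2 * omega k.

(* Being the sum of a power series on the disk includes holomorphy there. *)
Definition H2 omega f : Prop :=
  exists2 a, is_taylor f a & cvgn (series (sqnorm_term omega a)).

Definition normH omega f : R :=
  Num.sqrt (limn (series (sqnorm_term omega (taylor f)))).

(* For [f] and [g] in [H2 omega] this series converges, by Cauchy-Schwarz. *)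
Definition innerH omega f g : C :=
  csum (fun k => taylor f k * (taylor g k)^* * (omega k)%:C).

Definition kernelH omega w : C -> C :=
  fun x => csum (fun k => w^* ^+ k * x ^+ k / (omega k)%:C).

Definition H_inner omega f : Prop :=
  [/\ H2 omega f, normH omega f = 1
    & forall j, (0 < j)%N -> innerH omega (fun x => x ^+ j * f x) f = 0].

Definition gram omega n (z : 'I_n -> C) : 'M[C]_n :=
  \matrix_(i, j) innerH omega (kernelH omega (z i)) (kernelH omega (z j)).

Definition f_Z omega n (z : 'I_n -> C) : C -> C :=
  fun x => \det (block_mx (1%:M : 'M[C]_1) (const_mx 1)
                          (\col_i kernelH omega (z i) x) (gram omega z)).

(* The Shapiro-Shields function *)
Definition g_Z omega n (z : 'I_n -> C) : C -> C :=
  fun x => f_Z omega z x / (normH omega (f_Z omega z))%:C.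

End WeightedHardySpace.

(* Main.v *)
Require Import Defs.
From mathcomp Require Import all_boot all_order all_algebra.
From mathcomp Require Import all_classical all_reals all_analysis.
From mathcomp Require Import complex ring lra.
Set Implicit Arguments.
Unset Strict Implicit.
Unset Printing Implicit Defensive.
Import Order.TTheory GRing.Theory Num.Theory.
Import numFieldNormedType.Exports.
Local Open Scope classical_set_scope.
Local Open Scope complex_scope.
Local Open Scope ring_scope.

(** Expanding the determinant along its first column, and reading the constant [1]
    as the kernel at the origin, presents [f_Z] as a combination
    [sum_i c_i k_(w_i)] of kernels, whose nodes are the origin and the points of
    [Z] ([f_ZE]); the coefficient of the kernel at the origin is the Gram
    determinant. Moreover [f_Z] vanishes on [Z], because there two columns of the
    determinant coincide ([f_Z_zero]).

    By the reproducing property ([innerH_kernel_comb]), the inner product of a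
    holomorphic [g] with [f_Z] is [sum_i (c_i)^* g(w_i)]. For [g = x^j f_Z] every
    term is zero when [j > 0]: the factor [x^j] vanishes at the origin and [f_Z]
    at the other nodes. For [g = f_Z] only the origin contributes, so that the
    squared norm of [f_Z] is the conjugate of the Gram determinant times
    [f_Z(0)] ([sqnorm_f_Z]).

    It remains that this norm is not zero. Kernels at distinct points are linearly
    independent, because their Taylor coefficients contain a Vandermonde matrix
    ([kernel_comb_coef_eq0]); hence the Gram determinant is not zero
    ([gram_det_neq0]), so [f_Z] is a nontrivial combination of kernels at distinct
    nodes, the points of [Z] being nonzero, and its norm is positive.

    On the analytic side, the limit hypothesis on the weights makes the series of
    [k_w] converge on the disk by the ratio test ([kernel_taylor]), and Taylor
    coefficients are unique ([taylorE]). *)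

(** * Sums of complex series *)

Section Sums.
Context {R : realType}.
Local Notation C := R[i].
Implicit Types (u v : nat -> C) (s t : C).

Lemma csumE u s : is_csum u s -> csum u = s.
Proof. by move=> us; apply: cvg_lim us; exact: norm_hausdorff. Qed.

Lemma is_csumD u v s t :
  is_csum u s -> is_csum v t -> is_csum (fun k => u k + v k) (s + t).
Proof.
move=> us vt; rewrite /is_csum.
rewrite (_ : series _ = series (u : nat -> C^o) \+ series (v : nat -> C^o)).
  exact: cvgD us vt.
by apply/funext => n; rewrite /series /= big_split.
Qed.

Lemma is_csumZ (c : C) u s : is_csum u s -> is_csum (fun k => c * u k) (c * s).
Proof.
move=> us; rewrite /is_csum.
rewrite (_ : series _ = (fun n => c *: series (u : nat -> C^o) n)).
  exact: cvgZl_tmp us.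
by apply/funext => n; rewrite /series /= scaler_sumr.
Qed.

Lemma is_csum_sum n (u : 'I_n -> nat -> C) (s : 'I_n -> C) :
  (forall i, is_csum (u i) (s i)) ->
  is_csum (fun k => \sum_i u i k) (\sum_i s i).
Proof.
move=> us; rewrite /is_csum.
rewrite (_ : series _ = (fun m => \sum_i series (u i : nat -> C^o) m)).
  apply: cvg_big => [|i _]; last exact: us.
  move=> y; apply: cvgD; [exact: cvg_fst | exact: cvg_snd].
by apply/funext => m; rewrite /series /= exchange_big.
Qed.

Lemma is_csum_shift u s :
  is_csum (fun k => u k.+1) s <-> is_csum u (u 0%N + s).
Proof.
rewrite /is_csum -[X in _ <-> X](cvg_shiftS (series (u : nat -> C^o))).
have E : [sequence series (u : nat -> C^o) n.+1]_n =
    (fun n => u 0%N + series ((fun k => u k.+1) : nat -> C^o) n).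
  by apply/funext => n; rewrite /series /= big_nat_recl.
rewrite E; split=> h; first by apply: cvgD h; exact: cvg_cst.
have -> : series ((fun k => u k.+1) : nat -> C^o) =
    (fun n => (u 0%N + series ((fun k => u k.+1) : nat -> C^o) n) - u 0%N).
  by apply/funext => n; rewrite addrC addKr.
have -> : (s : C^o) = (u 0%N + s) - u 0%N by rewrite addrC addKr.
by apply: cvgB h _; exact: cvg_cst.
Qed.

Lemma cvg_Re (v : nat -> C^o) s : v @ \oo --> (s : C^o) ->
  (fun n => complex.Re (v n)) @ \oo --> complex.Re s.
Proof.
move=> /cvgrPdist_lt vs; apply/cvgrPdist_lt => e e0.
have := vs e%:C; rewrite ltcR => /(_ e0); apply: filterS => n.
rewrite -ltcR; apply: le_lt_trans.
by rewrite -raddfB; exact: normc_ge_Re.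
Qed.

Lemma cvg_real_complex (v : nat -> R) (l : R) : v @ \oo --> l ->
  (fun n => (v n)%:C : C^o) @ \oo --> (l%:C : C^o).
Proof.
move=> /cvgrPdist_lt vl; apply/cvgrPdist_lt => e e0.
have eE : e = (complex.Re e)%:C by rewrite RRe_real// gtr0_real.
move: e0; rewrite eE ltcR => /vl; apply: filterS => n.
by rewrite -rmorphB normc_def /= expr0n /= addr0 sqrtr_sqr ltcR.
Qed.

Lemma is_csum_real (u : nat -> R) s : is_csum (fun k => (u k)%:C) s ->
  series u @ \oo --> complex.Re s.
Proof.
move=> /cvg_Re; apply: cvg_trans; apply: near_eq_cvg; apply: nearW => n.
by rewrite /series /= raddf_sum.
Qed.

Lemma is_csum_realE (u : nat -> R) s : is_csum (fun k => (u k)%:C) s ->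
  (complex.Re s)%:C = s.
Proof.
move=> us; rewrite -[RHS](csumE us); apply/esym/csumE.
rewrite /is_csum (_ : series _ = (fun n => (series u n)%:C : C^o)).
  exact: cvg_real_complex (is_csum_real us).
by apply/funext => n; rewrite /series /= rmorph_sum.
Qed.

(** The real and imaginary parts of [u] are dominated by its modulus, so the
    completeness of the reals sums each of them separately. *)
Lemma is_csum_normc u : cvgn (series (fun k => Normc.normc (u k))) ->
  exists s, is_csum u s.
Proof.
move=> cu.
have cRe : cvgn (series (fun k => complex.Re (u k))).
  apply: normed_cvg; apply: series_le_cvg cu => // n; rewrite /= ?normr_ge0//.
    by rewrite -ler0c; exact: normr_ge0 (u n).
  by rewrite -lecR; exact: normc_ge_Re.
have cIm : cvgn (series (fun k => complex.Im (u k))).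
  apply: normed_cvg; apply: series_le_cvg cu => // n; rewrite /= ?normr_ge0//.
    by rewrite -ler0c; exact: normr_ge0 (u n).
  (* [Im x] is, up to sign, the real part of the rotated number [x * 'i]. *)
  rewrite -normrN -ReiNIm -lecR (le_trans (normc_ge_Re _))//.
  by rewrite normrM complexiE normCi mulr1.
exists ((limn (series (fun k => complex.Re (u k))))%:C +
  'i%C * (limn (series (fun k => complex.Im (u k))))%:C).
rewrite /is_csum.
have -> : series (u : nat -> C^o) =
    (fun n => (series (fun k => complex.Re (u k)) n)%:C
       + 'i%C *: ((series (fun k => complex.Im (u k)) n)%:C : C^o)).
  apply/funext => n; rewrite /series /=.
  rewrite 2!rmorph_sum scaler_sumr -big_split /=; apply: eq_bigr => k _.
  by rewrite [LHS]complexE.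
apply: cvgD; first exact: cvg_real_complex.
by apply: cvgZl_tmp; exact: cvg_real_complex.
Qed.

End Sums.

Arguments is_csumZ {R} c {u s}.

(** * Power series on the disk *)

Section PowerSeries.
Context {R : realType}.
Local Notation C := R[i].
Implicit Types (a b : nat -> C) (x : C) (f : C -> C).

Lemma sum_half_le n : \sum_(k < n) (2^-1 : C) ^+ k <= 2.
Proof.
have -> : \sum_(k < n) (2^-1 : C) ^+ k = 2 * (1 - 2^-1 ^+ n).
  elim: n => [|n IH]; first by rewrite big_ord0 expr0 subrr mulr0.
  by rewrite big_ord_recr /= IH exprS; field.
by rewrite ler_piMr// lerBlDr lerDl exprn_ge0// invr_ge0.
Qed.

(** Convergence at [1/2] bounds [a k] by [M * 2 ^+ k]; hence for small [t > 0]
    the terms of positive degree contribute at most [4 * M * t], and the vanishing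
    sum forces [|a 0| <= 4 * M * t] for every such [t]. *)
Lemma coef0_eq0 a :
  (forall x, 0 < `|x| < 1 -> is_csum (fun k => a k * x ^+ k) 0) -> a 0%N = 0.
Proof.
move=> a0.
have half_lt1 : 0 < `|2^-1 : C| < 1.
  by rewrite normfV normr_nat invr_gt0 ltr0n invf_lt1 ?ltr0n ?ltr1n.
have [M M_gt0 aM] : exists2 M : C, 0 < M & forall k, `|a k| <= M * 2 ^+ k.
  have /cvgP/cvg_series_cvg_0/cvgP/cvg_seq_bounded := a0 _ half_lt1.
  case=> M [Mreal aM]; exists (`|M| + 1); first by rewrite ltr_wpDl.
  move=> k; have := aM (`|M| + 1).
  rewrite (le_lt_trans (real_ler_norm Mreal)) ?ltrDl// => /(_ isT k I)/=.
  rewrite normrM normrX normfV normr_nat exprVn => aMk.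
  by rewrite -ler_pdivrMr ?exprn_gt0 ?ltr0n.
apply/eqP; apply: contraT => a0_neq0.
have A_gt0 : 0 < `|a 0%N| by rewrite normr_gt0.
set A := `|a 0%N| in A_gt0.
have D_gt0 : 0 < 8 * M + 4 * A by rewrite addr_gt0// mulr_gt0// ltr0n.
(* This [t] makes both [t <= 1/4] and [4 * M * t <= A / 2] hold. *)
pose t : C := A / (8 * M + 4 * A).
have t_gt0 : 0 < t by rewrite divr_gt0.
have t_le : t <= 4^-1.
  rewrite ler_pdivrMr// mulrDr mulKf ?pnatr_eq0// lerDr.
  by rewrite mulr_ge0 ?invr_ge0 ?ler0n// mulr_ge0 ?ler0n// ltW.
have Mt_le : 4 * M * t <= A / 2.
  rewrite /t mulrA ler_pdivrMr//.
  have -> : A / 2 * (8 * M + 4 * A) = 4 * M * A + 2 * A * A by field.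
  by rewrite lerDl !mulr_ge0 ?ler0n// ltW.
have t01 : 0 < `|t| < 1.
  by rewrite gtr0_norm// t_gt0 (le_lt_trans t_le)// invf_lt1 ?ltr1n ?ltr0n.
have /cvgrPdist_lt /(_ (A / 2)) := a0 t t01.
rewrite divr_gt0 ?ltr0n// => /(_ isT)[N _ /(_ N.+1 (leqnSn N))].
rewrite sub0r normrN => SN.
suff : A < A / 2 + A / 2 by rewrite -splitr ltxx.
have SE : series ((fun k => a k * t ^+ k) : nat -> C^o) N.+1 =
    a 0%N + t * \sum_(k < N) a k.+1 * t ^+ k.
  rewrite /series /= big_mkord big_ord_recl /= expr0 mulr1 mulr_sumr.
  by congr (_ + _); apply: eq_bigr => k _; rewrite exprS mulrCA.
have tail_le : `|t * \sum_(k < N) a k.+1 * t ^+ k| <= 4 * M * t.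
  rewrite normrM gtr0_norm// [leRHS]mulrC ler_pM2l//.
  apply: le_trans (ler_norm_sum _ _ _) _.
  have -> : 4 * M = M * 2 * 2 by ring.
  have M2_ge0 : 0 <= M * 2 by rewrite mulr_ge0 ?ler0n// ltW.
  apply: (le_trans _ (ler_wpM2l M2_ge0 (sum_half_le N))).
  rewrite mulr_sumr; apply: ler_sum => k _.
  rewrite normrM normrX (gtr0_norm t_gt0).
  have tk_ge0 : 0 <= t ^+ k by rewrite exprn_ge0// ltW.
  apply: (le_trans (ler_wpM2r tk_ge0 (aM k.+1))).
  rewrite exprS -!mulrA ler_pM2l// ler_pM2l ?ltr0n// -exprMn lerXn2r ?nnegrE//.
  - by rewrite mulr_ge0 ?ler0n// ltW.
  - have -> : (2^-1 : C) = 2 * 4^-1 by field.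
    by rewrite ler_pM2l ?ltr0n.
have : A <= `|a 0%N + t * \sum_(k < N) a k.+1 * t ^+ k| +
    `|t * \sum_(k < N) a k.+1 * t ^+ k|.
  rewrite /A -[X in `|X| <= _](addrK (t * \sum_(k < N) a k.+1 * t ^+ k)).
  exact: ler_normB.
rewrite -SE => h; apply: (le_lt_trans h).
apply: (ltr_leD SN); exact: le_trans tail_le Mt_le.
Qed.

(** The constant coefficient vanishes, so dividing by [x] yields the same
    situation for the shifted coefficients. The point [x = 0] is excluded in order
    that this division be possible. *)
Lemma coef_eq0 a :
  (forall x, 0 < `|x| < 1 -> is_csum (fun k => a k * x ^+ k) 0) ->
  forall k, a k = 0.
Proof.
move=> a0 k; elim: k a a0 => [|k IH] a a0; first exact: coef0_eq0.
apply: (IH (fun k => a k.+1)) => x x01.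
have := a0 x x01; rewrite -[X in is_csum _ X](subrK (a 0%N * x ^+ 0)).
rewrite addrC => /(@is_csum_shift _ (fun k => a k * x ^+ k)).
rewrite coef0_eq0// mul0r subr0 => /(is_csumZ x^-1); rewrite mulr0.
congr is_csum; apply/funext => j.
by rewrite exprS mulrCA (mulrA _ x) mulVf ?mul1r// -normr_gt0; case/andP: x01.
Qed.

(** Uniqueness of Taylor coefficients: this turns the choice made in [taylor]
    into a computation. *)
Lemma taylorE f a : is_taylor f a -> taylor f = a.
Proof.
move=> fa; have fb : is_taylor f (taylor f).
  exact: (@xgetPex _ _ [set a | is_taylor f a]) (ex_intro _ a fa).
apply/funext => k; apply/eqP; rewrite -subr_eq0; apply/eqP; move: k.
apply: coef_eq0 => x /andP[_ x1].
have := is_csumD (fb x x1) (is_csumZ (-1) (fa x x1)).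
rewrite mulN1r subrr; congr is_csum.
by apply/funext => k; rewrite mulN1r mulrBl.
Qed.

Lemma is_taylor_mulX f a : is_taylor f a ->
  is_taylor (fun x => x * f x) (fun k => if k is k'.+1 then a k' else 0).
Proof.
move=> fa x x1.
have -> : x * f x = 0 * x ^+ 0 + x * f x by rewrite mul0r add0r.
apply/(@is_csum_shift _ (fun k => (if k is k'.+1 then a k' else 0) * x ^+ k)).
have := is_csumZ x (fa x x1); congr is_csum.
by apply/funext => k; rewrite exprS mulrCA.
Qed.

Lemma is_taylorX j f a : is_taylor f a ->
  exists b, is_taylor (fun x => x ^+ j * f x) b.
Proof.
move=> fa; elim: j => [|j [b xb]].
  by exists a => x x1; rewrite mul1r; exact: fa.
exists (fun k => if k is k'.+1 then b k' else 0) => x x1.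
by rewrite exprS -mulrA; exact: (is_taylor_mulX xb).
Qed.

End PowerSeries.

(** * Convergence of the kernel series *)

Section Kernel.
Context {R : realType}.
Local Notation C := R[i].

Lemma ratio_test (u : nat -> R) r : (forall k, 0 <= u k) -> 0 <= r < 1 ->
  (\forall k \near \oo, u k.+1 <= r * u k) -> cvgn (series u).
Proof.
move=> u0 /andP[r0 r1] [N _ uN].
rewrite -(is_cvg_series_restrict N).
have vN : cvgn (series (fun k => u (k + N)%N)).
  have := @is_cvg_geometric_series R (u N) r.
  rewrite ger0_norm// => /(_ r1); apply: series_le_cvg => // k.
    by rewrite /geometric /= mulr_ge0// exprn_ge0.
  rewrite /geometric /=; elim: k => [|k IH]; first by rewrite expr0 mulr1.
  rewrite addSn (le_trans (uN _ _))/= ?leq_addl//.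
  by rewrite exprS mulrCA ler_wpM2l.
have /cvg_ex[l vl] := vN; apply/cvg_ex; exists l; rewrite -(cvg_shiftn N).
rewrite (_ : [sequence _]_n = series (fun k => u (k + N)%N))//.
by apply/funext => n; rewrite /series /= -{1}[N]add0n big_addn addnK.
Qed.

Context (omega : nat -> R) (omega_gt0 : forall k, 0 < omega k).
Context (omega_lim : (omega k / omega k.+1) @[k --> \oo] --> (1 : R)).

(** The ratio of consecutive terms is [t * (omega k / omega k.+1)], which tends to
    [t] and is therefore eventually below the midpoint of [t] and [1]. *)
Lemma cvg_kernel_series (t : R) : 0 <= t < 1 ->
  cvgn (series (fun k => t ^+ k / omega k)).
Proof.
move=> /andP[t0 t1].
apply: (@ratio_test _ ((1 + t) / 2)) => [k||].
- by rewrite divr_ge0 ?exprn_ge0// ltW.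
- by apply/andP; split; lra.
have tlim : (t * (omega k / omega k.+1)) @[k --> \oo] --> t * 1.
  exact: cvgMl_tmp.
have := cvgr_le _ tlim ((1 + t) / 2).
have -> : t * 1 < (1 + t) / 2 by lra.
move=> /(_ _ isT); apply: filterS => k hk.
have -> : t ^+ k.+1 / omega k.+1 =
    t * (omega k / omega k.+1) * (t ^+ k / omega k).
  by rewrite exprS; field; rewrite !gt_eqF.
by rewrite ler_wpM2r// divr_ge0 ?exprn_ge0// ltW.
Qed.

Lemma kernel_taylor (w : C) : `|w| < 1 ->
  is_taylor (kernelH omega w) (fun k => w^* ^+ k / (omega k)%:C).
Proof.
move=> w1 x x1; rewrite /kernelH.
have E : (fun k => w^* ^+ k / (omega k)%:C * x ^+ k) =
         (fun k => w^* ^+ k * x ^+ k / (omega k)%:C).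
  by apply/funext => k; rewrite mulrAC.
rewrite E.
suff [s us] : exists s, is_csum (fun k => w^* ^+ k * x ^+ k / (omega k)%:C) s.
  by rewrite (csumE us).
apply: is_csum_normc.
pose t := Normc.normc w * Normc.normc x.
have t01 : 0 <= t < 1.
  have tE : t%:C = `|w| * `|x| by rewrite rmorphM.
  rewrite -ler0c -ltcR tE mulr_ge0//=.
  by rewrite -[1%:C]mulr1 (le_lt_trans (ler_wpM2r _ (ltW w1)))// ltr_pM2l.
rewrite (_ : (fun k => _) = (fun k => t ^+ k / omega k)).
  exact: cvg_kernel_series.
apply/funext => k; apply: complexI.
rewrite -[LHS]/(`|w^* ^+ k * x ^+ k / (omega k)%:C|).
rewrite normrM normfV normrM !normrX norm_conjC -exprMn.
rewrite [`|(omega k)%:C|]gtr0_norm ?ltcR//.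
by rewrite rmorphM fmorphV rmorphXn rmorphM.
Qed.

End Kernel.

(** * Bordered determinants *)

Section BorderedDeterminant.
Context {F : comPzRingType} {n : nat}.
Local Notation i0 := (lshift n (ord0 : 'I_1)).
Implicit Types (u : 'M[F]_1) (r : 'rV[F]_n) (d : 'cV[F]_n) (D : 'M[F]_n).

Lemma cofactor_block_col0 u u' r d d' D (i : 'I_(1 + n)) :
  cofactor (block_mx u r d D) i i0 = cofactor (block_mx u' r d' D) i i0.
Proof.
have E : col' i0 (block_mx u r d D) = col' i0 (block_mx u' r d' D).
  apply/matrixP => k l; rewrite mxE [RHS]mxE.
  rewrite (_ : lift _ l = rshift 1 (l : 'I_n)); last exact: val_inj.
  by case: (split_ordP k) => k' ->; rewrite ?block_mxEur ?block_mxEdr.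
by rewrite /cofactor E.
Qed.

Lemma cofactor_block00 u r d D : cofactor (block_mx u r d D) i0 i0 = \det D.
Proof.
have E : row' i0 (col' i0 (block_mx u r d D)) = D.
  apply/matrixP => i j; rewrite 2!mxE.
  rewrite (_ : lift _ i = rshift 1 (i : 'I_n)); last exact: val_inj.
  rewrite (_ : lift _ j = rshift 1 (j : 'I_n)); last exact: val_inj.
  by rewrite block_mxEdr.
by rewrite /cofactor E expr0 mul1r.
Qed.

Lemma det_block_eq_cols d D j : (forall i, D i j = d i ord0) ->
  \det (block_mx (1%:M : 'M[F]_1) (const_mx 1) d D) = 0.
Proof.
move=> Dd; rewrite -det_tr.
apply: (@determinant_alternate _ _ _ (lshift n ord0) (rshift 1 j)) => // i.
rewrite 2![_^T _ _]mxE; case: (split_ordP i) => k ->.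
  by rewrite block_mxEul block_mxEur (ord1 k) !mxE.
by rewrite block_mxEdl block_mxEdr Dd.
Qed.

End BorderedDeterminant.

(** * Linear combinations of kernels *)

Section KernelComb.
Context {R : realType}.
Local Notation C := R[i].
Context (omega : nat -> R) (omega_gt0 : forall k, 0 < omega k).
Context (omega_lim : (omega k / omega k.+1) @[k --> \oo] --> (1 : R)).

Definition kernel_comb m (c w : 'I_m -> C) : C -> C :=
  fun x => \sum_i c i * kernelH omega (w i) x.

Definition kernel_comb_coef m (c w : 'I_m -> C) : nat -> C :=
  fun k => \sum_i c i * ((w i)^* ^+ k / (omega k)%:C).

Section FixedNodes.
Context (m : nat) (c w : 'I_m -> C) (w_disk : forall i, `|w i| < 1).
Local Notation F := (kernel_comb c w).
Local Notation a := (kernel_comb_coef c w).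

Lemma kernel_comb_taylor : is_taylor F a.
Proof.
move=> x x1.
have := is_csum_sum
  (fun i => is_csumZ (c i) (kernel_taylor omega_gt0 omega_lim (w_disk i) x1)).
congr is_csum; apply/funext => k; rewrite mulr_suml.
by apply: eq_bigr => i _; rewrite mulrA.
Qed.

(** Multiplying the conjugate of the [k]-th coefficient of a combination by
    [omega k] cancels the weight and leaves a combination of the powers
    [w i ^+ k]; pairing with [g] thus evaluates the power series of [g] at the
    nodes, where it converges. In this form the identity applies to
    [x ^+ j * f x] without an estimate of its norm. *)
Lemma reproducing_csum g b : is_taylor g b ->
  is_csum (fun k => b k * (a k)^* * (omega k)%:C) (\sum_i (c i)^* * g (w i)).
Proof.
move=> gb.
have := is_csum_sum (fun i => is_csumZ (c i)^* (gb _ (w_disk i))).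
congr is_csum; apply/funext => k.
rewrite /kernel_comb_coef rmorph_sum mulr_sumr mulr_suml; apply: eq_bigr => i _.
have ok0 : (omega k)%:C != 0 :> C by rewrite gt_eqF// ltcR.
have conj_ok : ((omega k)%:C : C)^* = (omega k)%:C.
  by apply: CrealP; rewrite gtr0_real ?ltcR.
rewrite !rmorphM fmorphV rmorphXn /= conjCK conj_ok.
by field.
Qed.

Lemma innerH_kernel_comb g b : is_taylor g b ->
  innerH omega g F = \sum_i (c i)^* * g (w i).
Proof.
move=> gb; rewrite /innerH (taylorE gb) (taylorE kernel_comb_taylor).
by rewrite (csumE (reproducing_csum gb)).
Qed.

(** The case [g = F]: it gives at once that [F] has finite norm and what the norm
    is. *)
Lemma sqnorm_csum :
  is_csum (fun k => (sqnorm_term omega a k)%:C) (\sum_i (c i)^* * F (w i)).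
Proof.
have := reproducing_csum kernel_comb_taylor; congr is_csum.
by apply/funext => k; rewrite /sqnorm_term rmorphM rmorphXn -normCK.
Qed.

Lemma kernel_comb_H2 : H2 omega F.
Proof.
exists a; first exact: kernel_comb_taylor.
by apply: cvgP; exact: is_csum_real sqnorm_csum.
Qed.

Lemma sqnorm_ge0 b k : 0 <= sqnorm_term omega b k.
Proof. by rewrite mulr_ge0 ?sqr_ge0// ltW. Qed.

Lemma normH_kernel_comb :
  (normH omega F)%:C ^+ 2 = \sum_i (c i)^* * F (w i).
Proof.
rewrite -rmorphXn /normH (taylorE kernel_comb_taylor).
have cv := is_csum_real sqnorm_csum.
rewrite (cvg_lim _ cv); last exact: norm_hausdorff.
rewrite sqr_sqrtr; last first.
  apply: (cvgr_to_ge cv); apply: nearW => n.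
  by apply: sumr_ge0 => k _; exact: sqnorm_ge0.
exact: is_csum_realE sqnorm_csum.
Qed.

(** The coefficients of degree less than [m] already determine [c]: up to the
    weights, they are the image of [c] under the Vandermonde matrix of the
    conjugated nodes. *)
Lemma kernel_comb_coef_eq0 : injective w -> (forall k, a k = 0) ->
  forall i, c i = 0.
Proof.
move=> w_inj a0 i.
pose v := \row_j c j.
pose V := (Vandermonde m (\row_j (w j)^*))^T.
have detV : \det V != 0.
  rewrite det_tr det_Vandermonde; apply/prodf_neq0 => j _.
  apply/prodf_neq0 => l jl; rewrite !mxE subr_eq0.
  by apply: contraTneq jl => /(inv_inj conjCK) /w_inj ->; rewrite ltnn.
have vV : v *m V = 0.
  apply/rowP => k; rewrite !mxE.
  have ok0 : (omega k)%:C^-1 != 0 :> C by rewrite invr_eq0 gt_eqF// ltcR.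
  apply: (mulIf ok0); rewrite mul0r -[RHS](a0 k) mulr_suml.
  by apply: eq_bigr => j _; rewrite !mxE mulrA.
have : v = 0.
  apply/eqP; apply: contraNT detV => v0.
  by apply/det0P; exists v.
by move=> /rowP/(_ i); rewrite !mxE.
Qed.

(** Linear independence of the kernels at distinct nodes, in metric form. *)
Lemma normH_eq0 : injective w -> normH omega F = 0 -> forall i, c i = 0.
Proof.
move=> w_inj; rewrite /normH (taylorE kernel_comb_taylor) => n0.
apply: kernel_comb_coef_eq0 => // k.
have cv := is_csum_real sqnorm_csum.
have := nondecreasing_cvgn_le _ (cvgP _ cv) k.+1.
have nd : nondecreasing_seq (series (sqnorm_term omega a)).
  by apply: nondecreasing_series => n _ _; exact: sqnorm_ge0.
move=> /(_ nd).
move/eqP : n0; rewrite sqrtr_eq0 => l0 /le_trans/(_ l0).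
rewrite seriesS => h.
have : sqnorm_term omega a k <= 0.
  by apply: le_trans h; rewrite lerDl sumr_ge0// => j _; exact: sqnorm_ge0.
rewrite /sqnorm_term pmulr_lle0// => h2.
have /eqP : Normc.normc (a k) ^+ 2 == 0 by rewrite eq_le h2 sqr_ge0.
by move/eqP; rewrite sqrf_eq0 => /eqP /Normc.eq0_normc.
Qed.

End FixedNodes.

Lemma gramE n (z : 'I_n -> C) i j : (forall i, `|z i| < 1) ->
  gram omega z i j = kernelH omega (z i) (z j).
Proof.
move=> z1; rewrite mxE.
have -> : kernelH omega (z j) = kernel_comb (fun=> 1) (fun _ : 'I_1 => z j).
  by apply/funext => x; rewrite /kernel_comb big_ord1 mul1r.
rewrite (innerH_kernel_comb _ _ (kernel_taylor omega_gt0 omega_lim (z1 i)))//.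
by rewrite big_ord1 rmorph1 mul1r.
Qed.

(** If [v] annihilates the Gram matrix, the combination of the kernels with
    coefficients [v] vanishes at every node, so its norm is zero. *)
Lemma gram_det_neq0 n (z : 'I_n -> C) : injective z ->
  (forall i, `|z i| < 1) -> \det (gram omega z) != 0.
Proof.
move=> z_inj z1; apply/det0P => -[v v0 vK].
have := v0; rewrite (_ : v = 0) ?eqxx//; apply/rowP => i; rewrite mxE.
apply: (@normH_eq0 _ (fun i => v 0 i) z z1 z_inj).
apply/complexI/eqP; rewrite -sqrf_eq0 normH_kernel_comb//; apply/eqP.
rewrite big1 // => j _.
rewrite (_ : kernel_comb _ _ _ = (v *m gram omega z) 0 j).
  by rewrite vK mxE mulr0.
by rewrite mxE; apply: eq_bigr => k _; rewrite gramE.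
Qed.

(** * The Shapiro-Shields function *)

Section ShapiroShields.
Context (omega0 : omega 0%N = 1) (n : nat) (z : 'I_n -> C).
Context (z_inj : injective z) (z_disk : forall i, `|z i| < 1).
Context (z_neq0 : forall i, z i != 0).

Lemma kernelH0 x : kernelH omega 0 x = 1.
Proof.
apply: csumE; rewrite -[X in is_csum _ X]addr0.
have E : (0 : C)^* ^+ 0 * x ^+ 0 / (omega 0%N)%:C = 1.
  by rewrite !expr0 omega0 mulr1 divr1.
rewrite -[X in is_csum _ (X + _)]E.
apply/(@is_csum_shift _ (fun k => 0^* ^+ k * x ^+ k / (omega k)%:C)).
rewrite /is_csum (_ : series _ = fun=> 0); first exact: cvg_cst.
apply/funext => k; rewrite /series /= big1// => j _.
by rewrite conjC0 exprS !mul0r.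
Qed.

(** The constant [1] in the corner of the determinant is the kernel at [0], so the
    origin is adjoined as an additional first node. *)
Definition points0 (i : 'I_(1 + n)) : C :=
  if fintype.split i is inr j then z j else 0.

(** The coefficients of [f_Z] on the kernels. The zeros in the first column make them visibly
    independent of the point where [f_Z] is evaluated. *)
Definition ss_coef (i : 'I_(1 + n)) : C :=
  cofactor (block_mx 0 (const_mx 1) 0 (gram omega z)) i (lshift n ord0).

Lemma points0l i : points0 (lshift n i) = 0.
Proof. by rewrite /points0 (unsplitK (inl i)). Qed.

Lemma points0r j : points0 (rshift 1 j) = z j.
Proof. by rewrite /points0 (unsplitK (inr j)). Qed.

Lemma points0_disk i : `|points0 i| < 1.
Proof. by rewrite /points0; case: fintype.split => // _; rewrite normr0. Qed.

Lemma points0_inj : injective points0.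
Proof.
move=> i j; rewrite /points0; case: (split_ordP i) => k ->;
  case: (split_ordP j) => l -> //.
- by rewrite (ord1 k) (ord1 l).
- by move=> /esym/eqP; rewrite (negPf (z_neq0 l)).
- by move=> /eqP; rewrite (negPf (z_neq0 k)).
- by move=> /z_inj ->.
Qed.

Lemma f_ZE : f_Z omega z = kernel_comb ss_coef points0.
Proof.
apply/funext => x; rewrite /f_Z (expand_det_col _ (lshift n ord0)) /kernel_comb.
apply: eq_bigr => i _; rewrite mulrC (cofactor_block_col0 _ 0 _ _ 0).
rewrite -/(ss_coef i) /points0; case: (split_ordP i) => k ->.
  by rewrite block_mxEul kernelH0 (ord1 k) mxE.
by rewrite block_mxEdl mxE.
Qed.

Lemma ss_coef0 : ss_coef (lshift n ord0) = \det (gram omega z).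
Proof. exact: cofactor_block00. Qed.

(** At [z j] the first column of the determinant repeats the column of [z j]. *)
Lemma f_Z_zero j : f_Z omega z (z j) = 0.
Proof.
by apply: (@det_block_eq_cols _ _ _ _ j) => i; rewrite gramE// mxE.
Qed.

(** Since [f_Z] vanishes at all nodes but the origin, pairing it with a combination
    of the kernels retains a single term. *)
Lemma sum_points0 (G : 'I_(1 + n) -> C) :
  \sum_i (G i)^* * f_Z omega z (points0 i) = (G (lshift n ord0))^* * f_Z omega z 0.
Proof.
rewrite big_split_ord big_ord1 points0l big1 => [|j _]; first exact: addr0.
by rewrite points0r f_Z_zero mulr0.
Qed.

Lemma sqnorm_f_Z :
  (normH omega (f_Z omega z))%:C ^+ 2 = (\det (gram omega z))^* * f_Z omega z 0.
Proof.
rewrite {1}f_ZE normH_kernel_comb -?f_ZE; last exact: points0_disk.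
by rewrite sum_points0 ss_coef0.
Qed.

Lemma normH_f_Z_neq0 : (normH omega (f_Z omega z))%:C != 0 :> C.
Proof.
rewrite f_ZE; apply: contra_neq (gram_det_neq0 z_inj z_disk) => /complexI N0.
by rewrite -ss_coef0; exact: normH_eq0 points0_disk points0_inj N0 _.
Qed.

Lemma g_ZE : g_Z omega z =
  kernel_comb (fun i => ss_coef i / (normH omega (f_Z omega z))%:C) points0.
Proof.
apply/funext => x; rewrite /g_Z {1}f_ZE /kernel_comb mulr_suml.
by apply: eq_bigr => i _; rewrite mulrAC.
Qed.

Lemma normH_ge0 f : 0 <= normH omega f.
Proof. exact: sqrtr_ge0. Qed.

Lemma g_Z_inner : H_inner omega (g_Z omega z).
Proof.
have w1 := points0_disk.
have N0 := normH_f_Z_neq0; set N := (normH _ _)%:C in N0.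
have NJ : N^* = N by apply: CrealP; rewrite ger0_real// ler0c normH_ge0.
have repr (g : C -> C) b : is_taylor g b -> innerH omega g (g_Z omega z) =
    \sum_i (ss_coef i / N)^* * g (points0 i).
  by rewrite g_ZE; exact: innerH_kernel_comb.
split.
- by rewrite g_ZE; exact: kernel_comb_H2.
- apply/eqP; rewrite -(@eqrXn2 _ 2)// ?normH_ge0 ?ler01//.
  apply/eqP/complexI; rewrite rmorphXn expr1n rmorph1 /= {1}g_ZE.
  rewrite normH_kernel_comb// -g_ZE.
  under eq_bigr => i _ do rewrite /g_Z mulrA.
  rewrite -mulr_suml (sum_points0 (fun i => ss_coef i / N)) ss_coef0.
  rewrite rmorphM fmorphV /= NJ -!mulrA (mulrCA N^-1) [LHS]mulrA -sqnorm_f_Z -/N.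
  by field.
- move=> j j_gt0.
  have [b gb] : exists b, is_taylor (fun x => x ^+ j * g_Z omega z x) b.
    by rewrite g_ZE; exact: is_taylorX (kernel_comb_taylor w1).
  rewrite (repr _ _ gb) big1// => i _.
  (* The power of [x] vanishes at the origin, and [f_Z] at the other nodes. *)
  rewrite /points0; case: (fintype.split i) => [_|k].
    by rewrite expr0n eqn0Ngt j_gt0 mul0r mulr0.
  by rewrite /g_Z f_Z_zero mul0r !mulr0.
Qed.

Lemma g_Z_formula x : g_Z omega z x =
     f_Z omega z x / sqrtC ((\det (gram omega z))^* * f_Z omega z 0).
Proof. by rewrite -sqnorm_f_Z sqrCK// ler0c normH_ge0. Qed.

End ShapiroShields.
End KernelComb.

Theorem theorem3p4 (R : realType) (omega : nat -> R)
    (omega_gt0 : forall k, 0 < omega k) (omega0 : omega 0%N = 1)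
    (omega_lim : (omega k / omega k.+1) @[k --> \oo] --> (1 : R))
    (n : nat) (z : 'I_n -> R[i]) (z_inj : injective z)
    (z_disk : forall i, `|z i| < 1) (z_neq0 : forall i, z i != 0) :
  H_inner omega (g_Z omega z) /\
  (forall x : R[i], `|x| < 1 ->
     g_Z omega z x =
     f_Z omega z x / sqrtC ((\det (gram omega z))^* * f_Z omega z 0)).
Proof.
by split=> [|x _]; [exact: g_Z_inner | exact: g_Z_formula].
Qed.
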